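(* Let $\omega\in\mathbb{R}^d\setminus\mathbb{Q}^d$, let $K>0$ be such that $\operatorname{osc}(X)\le K$ for all Birkhoff configurations $X$ of rotation vector $\omega$, and let $\delta_0,\varepsilon_0>0$ be the continuation constants for $K$ (see context). Then there is an $0<\varepsilon_1\le\varepsilon_0$ such that for all $0\le\varepsilon\le\varepsilon_1$ the following is true: when $x:\mathbb{Z}^d\to\mathbb{R}$ is a recurrent Birkhoff configuration of rotation vector $\omega$ with $V'(x_i)=0$ for all $i$ and every $x_i$ is a local minimum of $V$, then its continuation $x(\varepsilon)$ is Birkhoff.
   Context: Setting. Fix $d\ge 1$. A configuration is a map $x:\mathbb{Z}^d\to\mathbb{R}$; $\mathbb{R}^{\mathbb{Z}^d}$ carries the topology of pointwise convergence. Put $\|i\|=\sum_{k=1}^d|i_k|$ and $B_r(j)=\{k\in\mathbb{Z}^d : \|k-j\|\le r\}$. For $k\in\mathbb{Z}^d$, $l\in\mathbb{Z}$ let $(\tau_{k,l}x)_i=x_{i+k}+l$. $V:\mathbb{R}\to\mathbb{R}$ is a $C^2$, one-periodic Morse function ($V''\ne0$ at all critical points). The functions $S_j:\mathbb{R}^{\mathbb{Z}^d}\to\mathbb{R}$ ($j\in\mathbb{Z}^d$) satisfy: (A) there is an integer $r>0$ and for each $j$ a $C^2$ function $s_j:\mathbb{R}^{B_r(j)}\to\mathbb{R}$ with $S_j(x)=s_j(x|_{B_r(j)})$; (B) $S_j(\tau_{k,l}x)=S_{j+k}(x)$ for all $j,k\in\mathbb{Z}^d$, $l\in\mathbb{Z}$;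 (C) $\partial_{i,k}S_j\le 0$ for all $j$ and all $i\ne k$, and $\partial_{i,k}S_i<0$ whenever $\|i-k\|=1$. Put $R_i(x)=\sum_{j}\partial_iS_j(x)$. Equation $(E_\varepsilon)$ is: $V'(x_i)+\varepsilon R_i(x)=0$ for all $i\in\mathbb{Z}^d$; thus $(E_0)$ is $V'(x_i)=0$ for all $i$. Continuation. $\operatorname{osc}(x)=\sup_{\|j-i\|\le r}|x_j-x_i|$, $\|x\|_\infty=\sup_i|x_i|$, $B_\delta(x)=\{X\in\mathbb{R}^{\mathbb{Z}^d} : \|X-x\|_\infty<\delta\}$. Given $K>0$, the continuation constants are chosen as follows: let $c>0$ satisfy $|V''|>c$ at all critical points of $V$; let $C_1,C_2>0$ satisfy $|\partial_iS_j(X)|\le C_1/(2r+1)^d$ and $|\partial_{i,k}S_j(X)|\le C_2/(2r+1)^{2d}$ for all $i,j,k$ and all $X$ with $\operatorname{osc}(X)\le K+1$; fix $0<\kappa<1$; let $0<\delta_0<\frac12$ be such that $|V''(t)-V''(\sigma)|\le\kappa c/2$ whenever $\sigma$ is a critical point of $V$ and $|t-\sigma|<\delta_0$; let $\varepsilon_0=\min\{\frac{\kappa c}{2C_2},\frac{(1-\kappa)\delta_0c}{C_1}\}$. Then for every solution $x$ of $(E_0)$ with $\operatorname{osc}(x)\le K$ and every $0\le\varepsilon\le\varepsilon_0$ there is a unique solution of $(E_\varepsilon)$ in $B_{\delta_0}(x)$; it is denoted $x(\varepsilon)$ and called the continuation of $x$. Birkhoff configurations. For $x\ne y$ write $x<y$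 if $x_i\le y_i$ for all $i$; $x,y$ are ordered if $x<y$, $x=y$ or $x>y$, and a set is ordered if any two of its elements are. $x$ is Birkhoff if $\{\tau_{k,l}x : k\in\mathbb{Z}^d,l\in\mathbb{Z}\}$ is ordered. Every Birkhoff $x$ has a rotation vector: the unique $\omega\in\mathbb{R}^d$ with $|x_i-(x_0+\omega\cdot i)|\le1$ for all $i$; hence $\operatorname{osc}(x)\le r\|\omega\|+2$. A Birkhoff configuration $x$ of rotation vector $\omega\in\mathbb{R}^d\setminus\mathbb{Q}^d$ is recurrent if there are $(k_n,l_n)\in\mathbb{Z}^d\times\mathbb{Z}$ with $\omega\cdot k_n+l_n\ne0$ and $x=\lim_n\tau_{k_n,l_n}x$ pointwise. *)

(* Defs.v *)
From mathcomp Require Export all_boot all_order all_algebra.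
From mathcomp Require Export all_classical all_reals all_analysis.
Set Implicit Arguments.
Unset Strict Implicit.
Unset Printing Implicit Defensive.
Import Order.TTheory GRing.Theory Num.Theory.
Import numFieldNormedType.Exports.
Local Open Scope ring_scope.
Local Open Scope classical_set_scope.

Notation lattice d := 'rV[int]_d.

Definition norm1 (d : nat) (i : lattice d) : nat := (\sum_(k < d) `|i ord0 k|)%N.

Notation lball r j := {k : lattice _ | (norm1 (k - j)%R <= r)%N}.

Section Calculus.
Context {R : realType}.

(* For a function of a family of real variables indexed by I, the derivative
   in the variable i: that of the one-variable function obtained by freezing
   the coordinates of x other than i. *)
Definition section_at (I : eqType) (i : I) (f : (I -> R) -> R) (x : I -> R) :
  R -> R := fun t => f [eta x with i |-> t].

Definition partial (I : eqType) (i : I) (f : (I -> R) -> R) (x : I -> R) : R :=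
  derive1 (section_at i f x) (x i).

(* \partial_{i,k} f *)
Definition partial2 (I : eqType) (i k : I) (f : (I -> R) -> R) : (I -> R) -> R :=
  partial i (partial k f).

Definition has_partials (I : eqType) (f : (I -> R) -> R) : Prop :=
  forall (i : I) (x : I -> R), derivable (section_at i f x) (x i) 1.

(* Used only with finitely many variables, where the topology of {ptws I -> R}
   is the usual one of a finite-dimensional space. *)
Definition class_C2_vars (I : choiceType) (f : (I -> R) -> R) : Prop :=
  [/\ continuous (f : {ptws I -> R} -> R),
      has_partials f /\
        (forall i, continuous (partial i f : {ptws I -> R} -> R)) &
      forall k, has_partials (partial k f) /\
        (forall i, continuous (partial2 i k f : {ptws I -> R} -> R))].

Definition class_C2 (V : R -> R) : Prop :=
  [/\ forall t, derivable V t 1,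
      forall t, derivable (derive1 V) t 1 &
      continuous (derive1 (derive1 V))].

Definition morse (V : R -> R) : Prop :=
  forall t, derive1 V t = 0 -> derive1 (derive1 V) t != 0.

Definition local_minimum (V : R -> R) (t : R) : Prop :=
  \forall u \near t, V t <= V u.

End Calculus.

Section Configurations.
Context {R : realType} {d : nat}.

Definition config : Type := lattice d -> R.

Definition tau (k : lattice d) (l : int) (x : config) : config :=
  fun i => x (i + k) + l%:~R.

Definition osc (r : nat) (x : config) : \bar R :=
  ereal_sup [set (`|x p.2 - x p.1|)%:E |
              p in [set p : lattice d * lattice d | (norm1 (p.2 - p.1)%R <= r)%N]].

Definition supnorm (x : config) : \bar R :=
  ereal_sup [set (`|x i|)%:E | i in [set: lattice d]].

Definition supball (delta : R) (x : config) : set config :=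
  [set X | (supnorm (fun i => X i - x i)%R < delta%:E)%E].

Definition config_lt (x y : config) : Prop :=
  x <> y /\ forall i, x i <= y i.

Definition ordered (x y : config) : Prop :=
  [\/ config_lt x y, x = y | config_lt y x].

Definition ordered_set (A : set config) : Prop :=
  forall x y, A x -> A y -> ordered x y.

Definition birkhoff (x : config) : Prop :=
  ordered_set [set tau kl.1 kl.2 x | kl in [set: lattice d * int]].

Definition dot (omega : 'rV[R]_d) (i : lattice d) : R :=
  \sum_(k < d) omega ord0 k * (i ord0 k)%:~R.

Definition has_rotation_vector (x : config) (omega : 'rV[R]_d) : Prop :=
  forall i, `|x i - (x 0 + dot omega i)| <= 1.

Definition rational_vector (omega : 'rV[R]_d) : Prop :=
  exists q : 'rV[rat]_d, omega = map_mx ratr q.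

Definition recurrent (omega : 'rV[R]_d) (x : config) : Prop :=
  exists (k : nat -> lattice d) (l : nat -> int),
    (forall n, dot omega (k n) + (l n)%:~R != 0) /\
    {ptws, (fun n => tau (k n) (l n) x) @ \oo --> x}.

End Configurations.
Arguments config : clear implicits.

Section Model.
Context {R : realType} {d : nat}.
Variables (V : R -> R) (S : lattice d -> config R d -> R) (r : nat).

Definition finite_range : Prop :=
  forall j, exists s : (lball r j -> R) -> R,
    class_C2_vars s /\ forall x, S j x = s (fun k => x (val k)).

Definition shift_invariant : Prop :=
  forall (j k : lattice d) (l : int) (x : config R d),
    S j (tau k l x) = S (j + k) x.

Definition twist : Prop :=
  (forall (j i k : lattice d) (x : config R d),
     i != k -> partial2 i k (S j) x <= 0) /\
  (forall (i k : lattice d) (x : config R d),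
     norm1 (i - k) = 1%N -> partial2 i k (S i) x < 0).

(* The sum over the whole lattice is a finite-support sum: by finite range,
   the term of index j vanishes unless norm1 (i - j) <= r. *)
Definition total_force (i : lattice d) (x : config R d) : R :=
  \sum_(j \in [set: lattice d]) partial i (S j) x.

Definition solution (eps : R) (x : config R d) : Prop :=
  forall i, derive1 V (x i) + eps * total_force i x = 0.

Definition continuation_constants (K c C1 C2 kappa delta0 eps0 : R) : Prop :=
  [/\ 0 < c /\ (forall t, derive1 V t = 0 -> c < `|derive1 (derive1 V) t|),
      [/\ 0 < C1, 0 < C2 & forall X : config R d, (osc r X <= (K + 1)%:E)%E ->
        forall i j k : lattice d,
          `|partial i (S j) X| <= C1 / (2 * r + 1)%:R ^+ d /\
          `|partial2 i k (S j) X| <= C2 / (2 * r + 1)%:R ^+ (2 * d)],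
      0 < kappa < 1,
      0 < delta0 < 1 / 2 /\
        (forall sigma t, derive1 V sigma = 0 -> `|t - sigma| < delta0 ->
           `|derive1 (derive1 V) t - derive1 (derive1 V) sigma| <= kappa * c / 2) &
      eps0 = Num.min (kappa * c / (2 * C2)) ((1 - kappa) * delta0 * c / C1)].

Definition is_continuation (delta0 eps : R) (x X : config R d) : Prop :=
  [/\ supball delta0 x X, solution eps X &
      forall Y, supball delta0 x Y -> solution eps Y -> Y = X].

End Model.

(* Main.v *)
Require Import Defs.
From mathcomp Require Import ring lra zify.
Set Implicit Arguments.
Unset Strict Implicit.
Unset Printing Implicit Defensive.
Import Order.TTheory GRing.Theory Num.Theory.
Import numFieldNormedType.Exports.
Local Open Scope ring_scope.
Local Open Scope classical_set_scope.

(** The idea is a comparison principle: if [x <= y] are solutions of the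
    uncoupled problem made of minima of [V], then for small [eps] every solution
    close to [x] lies below every solution close to [y] ([comparison]).  At sites
    where [x i < y i] this is automatic, since two minima of [V] are at least
    [2 * delta0] apart ([wells_apart]).  At the other sites both solutions lie in
    the same well, where [V'] has slope at least [c / 2]; the twist condition says
    that the force at [i] decreases when the other entries increase
    ([total_force_antitone]), so a violation of the order at [i] could only be
    caused by violations at neighbouring sites, and as [eps] times the Lipschitz
    constant of the force ([total_force_lipschitz]) is small, it is at most half
    as large as the worst of these.  Hence there is none.

    Everything follows.  Two translates of a Birkhoff configuration [x] are
    ordered and consist of minima; translates of a solution are solutions
    ([total_force_tau], periodicity of [V]), so by comparison the corresponding
    translates of the continuation are ordered in the same way, which is the
    Birkhoff property.  Comparing [x] with itself gives the uniqueness of the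
    continuation.  Its existence also comes from monotonicity: a relaxation map
    for the equation preserves the order and a box around [x], so it has a fixed
    point there ([solution_near], [tarski_box]).

    The bounds on the force and the twist condition concern partial derivatives;
    they are turned into statements about differences by changing one entry at a
    time ([mix_lipschitz], [mix_antitone]). *)

(** * Calculus in one variable *)

Section OneVariable.
Context {R : realType}.
Implicit Types (f : R -> R) (a b t : R).

Lemma derive1_MVT f a b : (forall t, derivable f t 1) -> a < b ->
  exists2 t, a < t < b & f b - f a = derive1 f t * (b - a).
Proof.
move=> df ab.
have [||t tab ->] := @MVT R f (derive1 f) a b ab.
- by move=> t _; rewrite derive1E; apply/derivableP.
- by apply: derivable_within_continuous => t _; exact: df.
by exists t => //; move: tab; rewrite in_itv.
Qed.

Lemma derive1_shift f l a : derive1 (fun t => f (t + l)) a = derive1 f (a + l).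
Proof. by rewrite /derive1; under eq_fun do rewrite -addrA. Qed.

Lemma periodic_int f (l : int) t : periodic f 1 -> f (t + l%:~R) = f t.
Proof.
move=> f1; case: l => n; first by rewrite -pmulrn periodicn.
by rewrite NegzE mulrNz -[in RHS](subrK n.+1%:R t) -pmulrn periodicn.
Qed.

Lemma periodic_derive1 f : periodic f 1 -> periodic (derive1 f) 1.
Proof.
by move=> f1 t; rewrite -derive1_shift (_ : (fun u => f (u + 1)) = f) //; apply/funext.
Qed.

(** Near such a point the derivative is strictly decreasing, so it is negative
    just to the right and the function drops below its value at the point. *)
Lemma concave_not_local_minimum f a e : class_C2 f -> 0 < e -> derive1 f a = 0 ->
  (forall t, `|t - a| < e -> derive1 (derive1 f) t < 0) -> ~ local_minimum f a.
Proof.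
move=> [df ddf _] e0 fa f2 /nbhs_ballP[e1 /= e10 fmin].
pose u := a + Num.min e e1 / 2.
have m0 : 0 < Num.min e e1 by rewrite lt_min e0.
have [me me1] : Num.min e e1 <= e /\ Num.min e e1 <= e1 by rewrite !ge_min !lexx orbT.
have au : a < u by rewrite /u; lra.
have ue : u < a + e by rewrite /u; lra.
have /fmin : ball a e1 u.
  rewrite /ball /= distrC ger0_norm; last by rewrite subr_ge0 ltW.
  by rewrite /u; lra.
have [t /andP[at_ tu] Et] := derive1_MVT df au.
have [s /andP[as_ st] Es] := derive1_MVT ddf at_.
have s2 : derive1 (derive1 f) s < 0.
  by apply: f2; rewrite ger0_norm; lra.
have t0 : derive1 f t < 0.
  by rewrite fa subr0 in Es; rewrite Es nmulr_rlt0 ?subr_gt0.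
rewrite -subr_ge0 Et leNgt => /negP; apply.
by rewrite nmulr_rlt0 ?subr_gt0.
Qed.
End OneVariable.

(** * Changing a configuration one coordinate at a time *)

Section Coordinatewise.
Context {R : realType} {I : eqType}.
Implicit Types (g : (I -> R) -> R) (X Y Z x : I -> R) (s : seq I).

(** Walking from [X] to [Y] through the configurations [mix s X Y] changes a
    single coordinate per step, so that the one-variable mean value theorem
    applies to each step. *)
Definition mix s X Y : I -> R := fun k => if k \in s then Y k else X k.

Lemma mix_cons k s X Y : mix (k :: s) X Y = [eta mix s X Y with k |-> Y k].
Proof.
by apply/funext => j; rewrite /mix /= in_cons; case: eqVneq => [->|].
Qed.

Lemma section_at_update k g X t :
  section_at k g [eta X with k |-> t] = section_at k g X.
Proof.
apply/funext => u; congr g; apply/funext => j /=.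
by case: eqVneq.
Qed.

Lemma update_id k X : [eta X with k |-> X k] = X :> (I -> R).
Proof. by apply/funext => j /=; case: eqVneq => [->|]. Qed.

Lemma partial_MVT g k X b : has_partials g ->
  exists2 t, Num.min (X k) b <= t <= Num.max (X k) b &
    g [eta X with k |-> b] - g X = partial k g [eta X with k |-> t] * (b - X k).
Proof.
move=> dg; pose h := section_at k g X.
have dh t : derivable h t 1.
  by have := dg k [eta X with k |-> t]; rewrite section_at_update /= eqxx.
have hb : g [eta X with k |-> b] = h b by [].
have hX : g X = h (X k) by rewrite /h /section_at update_id.
have hp t : partial k g [eta X with k |-> t] = derive1 h t.
  by rewrite /partial section_at_update /= eqxx.
rewrite hb hX.
case: (ltgtP (X k) b) => [Xb|bX|<-].
- have [t /andP[? ?] Et] := derive1_MVT dh Xb.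
  by exists t; rewrite ?hp // !ltW.
- have [t /andP[? ?] Et] := derive1_MVT dh bX.
  by exists t; rewrite ?hp ?ltW // -[X in _ * X]opprB mulrN -Et opprB.
- by exists (X k); rewrite ?lexx // !subrr mulr0.
Qed.

Definition close (e : R) x X := forall k, `|X k - x k| < e.

Lemma close_mix e x s X Y : close e x X -> close e x Y -> close e x (mix s X Y).
Proof. by move=> Xx Yx k; rewrite /mix; case: ifP. Qed.

(** Every intermediate configuration takes each coordinate from [X] or from
    [Y], hence stays in the same sup-norm neighbourhood of [x], where the
    partial derivatives are controlled. *)
Lemma mix_lipschitz g e x (C M : R) s X Y : has_partials g ->
  (forall k Z, close e x Z -> `|partial k g Z| <= C) ->
  close e x X -> close e x Y -> (forall k, `|Y k - X k| <= M) ->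
  `|g (mix s X Y) - g X| <= (size s)%:R * (C * M).
Proof.
move=> dg gC Xx Yx XYM; elim: s => [|k s IH].
  by rewrite mul0r (_ : mix [::] X Y = X) ?subrr ?normr0.
have [t tb Et] := partial_MVT k (mix s X Y) (Y k) dg.
have mx : close e x (mix s X Y) by exact: close_mix.
rewrite mix_cons -(subrKA (g (mix s X Y))) (le_trans (ler_normD _ _)) //.
rewrite /= -natr1 mulrDl mul1r addrC lerD // Et normrM.
apply: ler_pM => //.
- apply: gC => j /=; case: eqVneq => [->|_]; last exact: mx.
  move: tb (mx k) (Yx k) => /andP[]; rewrite ge_min le_max !ltr_norml.
  by move=> /orP[?|?] /orP[?|?] /andP[? ?] /andP[? ?]; apply/andP; split; lra.
- rewrite /mix; case: ifP => // _.
  by rewrite subrr normr0 (le_trans _ (XYM k)).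
Qed.

(** The coordinate [i] never moves along the path, so only the partial
    derivatives of known sign are met. *)
Lemma mix_antitone g i s X Y : has_partials g ->
  (forall k Z, k != i -> partial k g Z <= 0) ->
  (forall k, X k <= Y k) -> X i = Y i -> g (mix s X Y) <= g X.
Proof.
move=> dg g0 XY XYi; elim: s => [|k s IH]; first by rewrite (_ : mix [::] X Y = X).
apply: le_trans IH; rewrite -subr_le0 mix_cons.
have [t tb ->] := partial_MVT k (mix s X Y) (Y k) dg.
have [->|ki] := eqVneq k i.
  by rewrite /mix XYi; case: ifP; rewrite subrr mulr0.
apply: mulr_le0_ge0; first exact: g0.
by rewrite subr_ge0 /mix; case: ifP.
Qed.

End Coordinatewise.

(** * Two order-theoretic principles *)

(** The supremum of [u] would be at most half of itself. *)
Lemma halving_le0 (R : realType) (I : Type) (u : I -> R) (b : R) :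
  (forall i, u i <= b) ->
  (forall M, 0 <= M -> (forall i, u i <= M) -> forall i, u i <= M / 2) ->
  forall i, u i <= 0.
Proof.
move=> ub half i; rewrite leNgt; apply/negP => ui.
have hu : has_ubound (range u) by exists b => _ [j _ <-].
have us j : u j <= sup (range u) by apply: ub_le_sup => //; exists j.
have s0 : 0 < sup (range u) by exact: lt_le_trans (us i).
have : sup (range u) <= sup (range u) / 2.
  apply: ge_sup; first by exists (u i), i.
  by move=> _ [j _ <-]; apply: half => //; exact: ltW.
by move: s0; set s := sup _; lra.
Qed.

(** The Knaster-Tarski fixed point theorem in an order interval of real
    families: the pointwise supremum of all [X] with [X <= T X] is fixed. *)
Lemma tarski_box (R : realType) (I : Type) (lo hi : I -> R)
    (T : (I -> R) -> I -> R) :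
  let box X := forall i, lo i <= X i <= hi i in
  (forall i, lo i <= hi i) ->
  (forall X Y, box X -> box Y -> (forall i, X i <= Y i) ->
     forall i, T X i <= T Y i) ->
  (forall i, lo i <= T lo i) -> (forall i, T hi i <= hi i) ->
  exists2 X, box X & T X = X.
Proof.
move=> box lohi Tmono Tlo Thi.
pose A := [set X | box X /\ forall i, X i <= T X i].
have box_lo : box lo by move=> i; rewrite lexx lohi.
have box_hi : box hi by move=> i; rewrite lexx lohi.
have Alo : A lo by split.
pose X i := sup [set Y i | Y in A].
have ubX i : ubound [set Y i | Y in A] (hi i).
  by move=> _ [Y [/(_ i) /andP[_ Yhi] _] <-].
have leX Y i : A Y -> Y i <= X i.
  by move=> AY; apply: ub_le_sup; [exists (hi i); exact: ubX | exists Y].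
have geX i b : (forall Y, A Y -> Y i <= b) -> X i <= b.
  move=> AYb; apply: ge_sup; first by exists (lo i), lo.
  by move=> _ [Y AY <-]; exact: AYb.
have bX : box X.
  move=> i; rewrite leX //= geX // => Y AY.
  by apply: ubX; exists Y.
have XT i : X i <= T X i.
  apply: geX => Y AY; have [bY /(_ i) YT] := AY.
  by apply: le_trans YT _; apply: Tmono => // j; exact: leX.
have bTX : box (T X).
  move=> i; apply/andP; split.
    by apply: le_trans (XT i); have /andP[] := bX i.
  apply: le_trans (Thi i); apply: Tmono => // j.
  by have /andP[] := bX j.
have ATX : A (T X) by split => // i; exact: Tmono.
exists X => //; apply/funext => i; apply/eqP.
by rewrite eq_le XT leX.
Qed.

(** * Monotone perturbations of uncoupled wells *)

(** The system [f (X i) + eps * F i X = 0] for a coupling [F] that decreases in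
    the other coordinates. *)
Section MonotonePerturbation.
Context {R : realType} {I : eqType}.
Variables (f : R -> R) (F : I -> (I -> R) -> R) (m delta : R).
Hypotheses (m_gt0 : 0 < m).
Hypothesis F_antitone : forall i X Y,
  (forall k, X k <= Y k) -> X i = Y i -> F i Y <= F i X.
Implicit Types (x y X Y : I -> R) (s t : R).

(** A zero of [f] around which [f] is uniformly increasing: for [f] the
    derivative of a potential, a nondegenerate minimum. *)
Definition well s := f s = 0 /\ exists A, forall a b,
  `|a - s| < delta -> `|b - s| < delta -> a <= b ->
  m * (b - a) <= f b - f a <= A * (b - a).

Definition lipschitz_near (B : R) x := forall X Y M,
  close delta x X -> close delta x Y -> (forall k, `|Y k - X k| <= M) ->
  forall i, `|F i Y - F i X| <= B * M.

(** If the two neighbourhoods overlapped, [f] would be positive at the midpoint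
    when seen from [s] and negative when seen from [t]. *)
Lemma wells_apart s t : well s -> well t -> s < t -> s + delta <= t - delta.
Proof.
move=> [fs [A sA]] [ft [A' tA]] st; rewrite leNgt; apply/negP => st2.
pose u := (s + t) / 2.
have /sA : `|s - s| < delta by rewrite ltr_norml; apply/andP; split; lra.
have us : `|u - s| < delta by rewrite ltr_norml /u; apply/andP; split; lra.
have ut : `|u - t| < delta by rewrite ltr_norml /u; apply/andP; split; lra.
have su : s <= u by rewrite /u; lra.
have tu : u <= t by rewrite /u; lra.
move=> /(_ u us su) /andP[su' _].
have /(tA u t ut) : `|t - t| < delta by rewrite ltr_norml; apply/andP; split; lra.
move=> /(_ tu) /andP[tu' _].
have p1 : 0 < m * (u - s) by rewrite mulr_gt0 // /u; lra.
have p2 : 0 < m * (t - u) by rewrite mulr_gt0 // /u; lra.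
lra.
Qed.

(** Put [W = min (X, Y)]; the claim is that the nonnegative [X - W] vanishes.
    Where [Y i < X i], the wells [x i] and [y i] must be the same, because
    different wells are too far apart.  Consequently [W] is still close to [x],
    even though [x] and [y] may be far from each other, and the Lipschitz bound
    around [x] applies to the pair [W], [X].  At such an [i] monotonicity of the
    coupling makes [W] a supersolution; subtracting the two inequalities, the
    slope [m] of the well beats the coupling and gives [X i - W i <= M / 2] for
    any bound [M] of [X - W]. *)
Lemma comparison eps B x y X Y :
  0 <= eps -> eps * B <= m / 2 ->
  (forall i, well (x i)) -> (forall i, well (y i)) -> (forall i, x i <= y i) ->
  lipschitz_near B x -> close delta x X -> close delta y Y ->
  (forall i, f (X i) + eps * F i X <= 0) ->
  (forall i, 0 <= f (Y i) + eps * F i Y) ->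
  forall i, X i <= Y i.
Proof.
move=> e0 eB wx wy xy LB Xx Yy subX supY.
pose W i := Num.min (X i) (Y i).
have WX i : W i <= X i by rewrite ge_min lexx.
have WY i : W i <= Y i by rewrite ge_min lexx orbT.
have xyE i : Y i < X i -> x i = y i.
  move=> YX; have := xy i; rewrite le_eqVlt => /orP[/eqP//|].
  move=> /(wells_apart (wx i) (wy i)).
  by move: (Xx i) (Yy i); rewrite !ltr_norml => /andP[? ?] /andP[? ?]; lra.
have Wx : close delta x W.
  move=> i; rewrite /W; case: (leP (X i) (Y i)) => [_|/xyE ->]; first exact: Xx.
  exact: Yy.
suff XW i : X i - W i <= 0.
  by move=> i; apply: le_trans (WY i); rewrite -subr_le0.
move: i; apply: (@halving_le0 _ _ _ (2 * delta)) => [i|M M0 XWM i].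
  by move: (Xx i) (Wx i); rewrite !ltr_norml => /andP[? ?] /andP[? ?]; lra.
case: (leP (X i) (Y i)) => [XY|YX].
  by rewrite /W min_l // subrr divr_ge0.
have Wi : W i = Y i by rewrite /W min_r // ltW.
have [_ [A /(_ (W i) (X i) (Wx i) (Xx i) (WX i)) /andP[fXW _]]] := wx i.
have FYW : F i Y <= F i W by exact: F_antitone.
have /ler_normlP[FWX _] : `|F i X - F i W| <= B * M.
  by apply: LB => // k; rewrite ger0_norm ?subr_ge0.
have h1 : eps * F i Y <= eps * F i W by rewrite ler_wpM2l.
have h2 : eps * (F i W - F i X) <= eps * (B * M).
  by rewrite ler_wpM2l //; lra.
have h3 : eps * B * M <= m / 2 * M by rewrite ler_wpM2r.
have := subX i; have := supY i; rewrite -Wi => h4 h5.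
have : m * (X i - W i) <= m * (M / 2) by lra.
by rewrite ler_pM2l.
Qed.

(** The solutions are the fixed points of the relaxation map
    [T X i = X i - (f (X i) + eps * F i X) / D i].  When [D i] exceeds the largest
    slope of [f] in the well plus that of [eps * F i] in its own coordinate, [T]
    is monotone.  It maps the box of radius [e] around [x] into itself since on
    its boundary [f] is at least [m * e] in absolute value and dominates the
    coupling. *)
Lemma solution_near eps A B e x :
  0 <= eps -> 0 <= B -> 0 < e < delta -> eps * A <= m * e ->
  (forall i, well (x i)) -> lipschitz_near B x ->
  (forall X i, close delta x X -> `|F i X| <= A) ->
  exists2 X, (forall i, `|X i - x i| <= e) &
    forall i, f (X i) + eps * F i X = 0.
Proof.
move=> e0 B0 /andP[e_gt0 ed] eA wx LB FA.
have /choice[a xa] i := (wx i).2.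
pose D i := `|a i| + eps * B + 1.
have D0 i : 0 < D i by rewrite /D ltr_pwDr // addr_ge0 // mulr_ge0.
pose T X i := X i - (f (X i) + eps * F i X) / D i.
have boxx X : (forall i, x i - e <= X i <= x i + e) -> close delta x X.
  by move=> bX i; rewrite ltr_norml; move: (bX i) => /andP[? ?]; apply/andP; split; lra.
have [||||X bX TX] := @tarski_box R I (fun i => x i - e) (fun i => x i + e) T.
- by move=> i; lra.
- move=> X Y bX bY XY i.
  (* Raise the coordinate [i] first: this costs at most [B]; the others only help. *)
  pose Z := [eta X with i |-> Y i] : I -> R.
  have Zx : close delta x Z.
    by move=> k; rewrite /Z /=; case: eqVneq => [->|_]; apply: boxx.
  have FYZ : F i Y <= F i Z.
    apply: F_antitone; last by rewrite /Z /= eqxx.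
    by move=> k; rewrite /Z /=; case: eqVneq => [->|_].
  have /ler_normlP[_ FZX] : `|F i Z - F i X| <= B * (Y i - X i).
    apply: LB => //; first exact: boxx.
    move=> k; rewrite /Z /=; case: eqVneq => [->|_].
      by rewrite ger0_norm ?subr_ge0.
    by rewrite subrr normr0 subr_ge0.
  have /andP[_ fXY] := xa i _ _ (boxx _ bX i) (boxx _ bY i) (XY i).
  have XYi : 0 <= Y i - X i by rewrite subr_ge0.
  rewrite -subr_ge0 /T.
  have -> : Y i - (f (Y i) + eps * F i Y) / D i - (X i - (f (X i) + eps * F i X) / D i)
     = (Y i - X i) - (f (Y i) - f (X i) + eps * (F i Y - F i X)) / D i by ring.
  rewrite subr_ge0 ler_pdivrMr // mulrC.
  have h1 : eps * (F i Y - F i X) <= eps * (B * (Y i - X i)).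
    by rewrite ler_wpM2l //; lra.
  have h2 : a i * (Y i - X i) <= `|a i| * (Y i - X i) by rewrite ler_wpM2r // ler_norm.
  by rewrite /D; lra.
- move=> i; have xx : `|x i - x i| < delta by rewrite subrr normr0; lra.
  have lx : `|x i - e - x i| < delta by rewrite ltr_norml; apply/andP; split; lra.
  have /andP[fl _] := xa i _ _ lx xx (ltac:(lra) : x i - e <= x i).
  have /ler_normlP[_ Fl] : `|F i (fun i => x i - e)| <= A.
    by apply: FA; apply: boxx => k; apply/andP; split; lra.
  have h : eps * F i (fun i => x i - e) <= eps * A by rewrite ler_wpM2l.
  rewrite /T lerBrDr gerDl pmulr_lle0 ?invr_gt0 //.
  by move: fl; rewrite (wx i).1; lra.
- move=> i; have xx : `|x i - x i| < delta by rewrite subrr normr0; lra.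
  have lx : `|x i + e - x i| < delta by rewrite ltr_norml; apply/andP; split; lra.
  have /andP[fl _] := xa i _ _ xx lx (ltac:(lra) : x i <= x i + e).
  have /ler_normlP[Fl _] : `|F i (fun i => x i + e)| <= A.
    by apply: FA; apply: boxx => k; apply/andP; split; lra.
  have h : eps * - F i (fun i => x i + e) <= eps * A by rewrite ler_wpM2l.
  rewrite /T gerBl pmulr_lge0 ?invr_gt0 //.
  by move: fl; rewrite (wx i).1; lra.
exists X => i.
  by rewrite ler_norml; move: (bX i) => /andP[? ?]; apply/andP; split; lra.
have /eqP : T X i = X i by rewrite TX.
rewrite /T subr_eq -subr_eq0 opprD addrA subrr sub0r oppr_eq0 mulf_eq0 invr_eq0.
by rewrite (gt_eqF (D0 i)) orbF => /eqP.
Qed.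

End MonotonePerturbation.

(** * The force of a finite-range interaction *)

Section Lattice.
Context {d : nat}.

Lemma norm1N (i : lattice d) : norm1 (- i) = norm1 i.
Proof. by apply: eq_bigr => k _; rewrite mxE abszN. Qed.

Lemma finite_norm1_ball r : finite_set [set k : lattice d | (norm1 k <= r)%N].
Proof.
pose h (a : 'rV['I_(r + r).+1]_d) : lattice d := \row_j ((a ord0 j)%:Z - r%:Z).
apply: (@sub_finite_set _ _ (range h)); last exact/finite_image/finite_finset.
move=> k /= kr; exists (\row_j inord (absz (k ord0 j + r%:Z))) => //.
apply/rowP => j; rewrite !mxE.
have: (`|k ord0 j| <= r)%N.
  by apply: leq_trans kr; rewrite /norm1 (bigD1 j) //= leq_addr.
by move: (k _ _) => z zr; rewrite inordK; lia.
Qed.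

Definition ball_seq r : seq (lattice d) :=
  finmap.enum_fset (fset_set [set k : lattice d | (norm1 k <= r)%N]).

Lemma mem_ball_seq r k : (k \in ball_seq r) = (norm1 k <= r)%N.
Proof.
rewrite /ball_seq in_fset_set; last exact: finite_norm1_ball.
by apply/idP/idP; rewrite inE.
Qed.

End Lattice.

Section Force.
Context {R : realType} {d : nat}.
Variables (S : lattice d -> config R d -> R) (r : nat).
Implicit Types (i j k : lattice d) (l : int) (x X Y Z : config R d).
Hypothesis SA : finite_range S r.

Lemma eq_on_ball j X Y :
  (forall k, (norm1 (k - j) <= r)%N -> X k = Y k) -> S j X = S j Y.
Proof.
move=> XY; have [s [_ Ss]] := SA j.
by rewrite !Ss; congr s; apply/funext => k; apply: XY; exact: (valP k).
Qed.

Lemma partial_out i j X : ~~ (norm1 (i - j) <= r)%N -> partial i (S j) X = 0.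
Proof.
move=> ij; rewrite /partial (_ : section_at i (S j) X = cst (S j X)).
  by rewrite derive1_cst.
apply/funext => t; apply: eq_on_ball => k kj /=.
by case: eqVneq => // ki; rewrite ki (negPf ij) in kj.
Qed.

Lemma partial_local i j X Y :
  (forall k, (norm1 (k - j) <= r)%N -> X k = Y k) ->
  partial i (S j) X = partial i (S j) Y.
Proof.
move=> XY; have [ij|ij] := boolP (norm1 (i - j) <= r)%N; last first.
  by rewrite !partial_out.
rewrite /partial (XY i ij).
rewrite (_ : section_at i (S j) X = section_at i (S j) Y) //; apply/funext => t.
by apply: eq_on_ball => k kj /=; rewrite XY.
Qed.

(** Regularity is given only for the local function on the ball around [j];
    a coordinate outside the ball contributes a constant section. *)
Lemma has_partials_partial i j : has_partials (partial i (S j)).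
Proof.
move=> k X.
have [ij|ij] := boolP (norm1 (i - j) <= r)%N; last first.
  rewrite (_ : section_at _ _ _ = cst 0); first exact: derivable_cst.
  by apply/funext => t; rewrite /section_at partial_out.
have [kj|kj] := boolP (norm1 (k - j) <= r)%N; last first.
  rewrite (_ : section_at _ _ _ = cst (partial i (S j) X)).
    exact: derivable_cst.
  apply/funext => t; apply: partial_local => k' k'j /=.
  by case: eqVneq => // k'k; rewrite k'k (negPf kj) in k'j.
have [s [[_ _ s2] Ss]] := SA j.
have [ds _] := s2 (exist _ i ij).
pose restr Y : lball r j -> R := fun u => Y (val u).
have upd (q : lball r j) t Y :
    restr [eta Y with val q |-> t] = [eta restr Y with q |-> t].
  by apply/funext => u; rewrite /restr /= val_eqE.
have E Y : partial i (S j) Y = partial (exist _ i ij) s (restr Y).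
  rewrite /partial; congr (derive1 _ _); apply/funext => t.
  by rewrite /section_at Ss -upd.
rewrite (_ : section_at _ _ _ =
  section_at (exist _ k kj) (partial (exist _ i ij) s) (restr X)).
  exact: ds (exist _ k kj) (restr X).
by apply/funext => t; rewrite /section_at E -upd.
Qed.

(** Indexing the sum by the displacement from [i] makes its range independent
    of [i]: the bounds below become uniform, translation becomes termwise. *)
Lemma total_forceE i X :
  total_force S i X = \sum_(j <- ball_seq r) partial i (S (i + j)) X.
Proof.
rewrite /total_force (reindex_fsbigT (fun j => i + j)); last first.
  by exists (fun j => - i + j) => j; rewrite ?addKr ?addNKr.
rewrite -(fsbig_widen [set k : lattice d | (norm1 k <= r)%N]) //.
  by rewrite fsbig_finite //; exact: finite_norm1_ball.
move=> j [_ /negP jr]; rewrite /= partial_out //.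
by rewrite opprD addNKr norm1N.
Qed.

Lemma partial_local_seq i j X Y :
  (forall k, k \in [seq i + j + k | k <- ball_seq r] -> X k = Y k) ->
  partial i (S (i + j)) X = partial i (S (i + j)) Y.
Proof.
move=> XY; apply: partial_local => k kr; apply: XY.
by apply/mapP; exists (k - (i + j)); rewrite ?mem_ball_seq // addrC subrK.
Qed.

Lemma total_force_bound (C : R) X i :
  (forall i j, `|partial i (S j) X| <= C) ->
  `|total_force S i X| <= (size (@ball_seq d r))%:R * C.
Proof.
move=> SC; rewrite total_forceE (le_trans (ler_norm_sum _ _ _)) //.
apply: le_trans (ler_sum _ (fun j _ => SC i (i + j))) _.
by rewrite big_const_seq count_predT iter_addr_0 mulr_natl.
Qed.

Lemma total_force_lipschitz (e C : R) x :
  (forall i j k Z, close e x Z -> `|partial2 k i (S j) Z| <= C) ->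
  lipschitz_near (total_force S) e ((size (@ball_seq d r))%:R ^+ 2 * C) x.
Proof.
move=> SC X Y M Xx Yx XYM i.
rewrite !total_forceE -sumrB (le_trans (ler_norm_sum _ _ _)) //.
have h j : `|partial i (S (i + j)) Y - partial i (S (i + j)) X| <=
   (size (@ball_seq d r))%:R * (C * M).
  pose s := [seq i + j + k | k <- ball_seq r].
  have <- : partial i (S (i + j)) (mix s X Y) = partial i (S (i + j)) Y.
    by apply: partial_local_seq => k ks; rewrite /mix ks.
  have := @mix_lipschitz _ _ (partial i (S (i + j))) e x C M s X Y.
  rewrite size_map; apply => //; first exact: has_partials_partial.
  by move=> k Z Zx; exact: SC.
apply: le_trans (ler_sum _ (fun j _ => h j)) _.
rewrite big_const_seq count_predT iter_addr_0 -[X in X <= _]mulr_natl expr2.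
by rewrite !mulrA.
Qed.

Lemma total_force_antitone i X Y : twist S ->
  (forall k, X k <= Y k) -> X i = Y i -> total_force S i Y <= total_force S i X.
Proof.
move=> [ST _] XY XYi; rewrite !total_forceE; apply: ler_sum => j _.
pose s := [seq i + j + k | k <- ball_seq r].
have <- : partial i (S (i + j)) (mix s X Y) = partial i (S (i + j)) Y.
  by apply: partial_local_seq => k ks; rewrite /mix ks.
apply: (mix_antitone (i := i)) => //; first exact: has_partials_partial.
by move=> k Z ki; exact: ST.
Qed.

Lemma total_force_tau k l i X : shift_invariant S ->
  total_force S i (tau k l X) = total_force S (i + k) X.
Proof.
move=> SB; rewrite !total_forceE; apply: eq_bigr => j _.
rewrite /partial -(derive1_shift _ l%:~R (X (i + k))).
congr (derive1 _ _); apply/funext => t.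
rewrite /section_at [i + k + j]addrAC -(SB _ k l); congr (S _ _).
apply/funext => q; rewrite /tau /=.
by rewrite (inj_eq (addIr k)); case: ifP.
Qed.

End Force.

(** * Minima of the potential as wells *)

Section Wells.
Context {R : realType}.
Implicit Types (f V : R -> R).

Lemma well_shift f m delta s (l : int) : periodic f 1 ->
  well f m delta s -> well f m delta (s + l%:~R).
Proof.
move=> f1 [fs [A sA]]; split; first by rewrite periodic_int.
exists A => a b al bl ab.
have fl t : f (t - l%:~R) = f t by rewrite -[in RHS](subrK l%:~R t) periodic_int.
have := sA (a - l%:~R) (b - l%:~R); rewrite !fl (_ : b - l%:~R - (a - l%:~R) = b - a);
  last by ring.
apply.
- by rewrite -addrA -opprD [l%:~R + s]addrC.
- by rewrite -addrA -opprD [l%:~R + s]addrC.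
- by rewrite lerD2r.
Qed.

(** A minimum rules out [V'' < -c], hence [V'' > c] there and [V'' >= c / 2]
    nearby. *)
Lemma local_minimum_well V (c delta q s : R) : class_C2 V ->
  c < `|derive1 (derive1 V) s| -> q <= c / 2 -> 0 < delta -> 0 < c ->
  (forall t, `|t - s| < delta ->
     `|derive1 (derive1 V) t - derive1 (derive1 V) s| <= q) ->
  derive1 V s = 0 -> local_minimum V s -> well (derive1 V) (c / 2) delta s.
Proof.
move=> VC2 cs qc d0 c0 Vq Vs Vmin.
have cV : c < derive1 (derive1 V) s.
  case: (ltP (derive1 (derive1 V) s) 0) => [V0|V0]; last by rewrite ger0_norm in cs.
  case: (concave_not_local_minimum VC2 d0 Vs _ Vmin) => t /Vq.
  rewrite ltr0_norm // in cs.
  move: (derive1 (derive1 V) t) (derive1 (derive1 V) s) cs => vt vs cs.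
  by rewrite ler_norml => /andP[_]; lra.
split=> //; exists (derive1 (derive1 V) s + q) => a b sa sb.
rewrite le_eqVlt => /orP[/eqP->|ab]; first by rewrite !subrr !mulr0 lexx.
have [_ ddV _] := VC2; have [t /andP[at_ tb] ->] := derive1_MVT ddV ab.
have /Vq : `|t - s| < delta.
  by move: sa sb; rewrite !ltr_norml => /andP[? ?] /andP[? ?]; apply/andP; split; lra.
move: (derive1 (derive1 V) t) (derive1 (derive1 V) s) cV => vt vs cV.
rewrite ler_norml => /andP[? ?]; rewrite !ler_pM2r ?subr_gt0 //.
by apply/andP; split; lra.
Qed.

End Wells.

(** * Neighbourhoods and translates of configurations *)

Section Configurations.
Context {R : realType} {d : nat}.
Implicit Types (x X : config R d).

Lemma osc_leP r x (K : R) : (osc r x <= K%:E)%E <->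
  forall i j, (norm1 (j - i) <= r)%N -> `|x j - x i| <= K.
Proof.
split=> [xK i j ij|xK].
  by rewrite -lee_fin; apply: le_trans xK; apply: ereal_sup_ubound; exists (i, j).
by apply: ge_ereal_sup => _ [[i j] /= ij <-]; rewrite lee_fin; exact: xK.
Qed.

Lemma supball_close (e : R) x X : supball e x X -> close e x X.
Proof.
move=> xX i; rewrite -lte_fin; apply: le_lt_trans xX.
by apply: ereal_sup_ubound; exists i.
Qed.

Lemma le_supball (e e' : R) x X : e < e' ->
  (forall i, `|X i - x i| <= e) -> supball e' x X.
Proof.
move=> ee' xX; rewrite /supball /=; apply: (@le_lt_trans _ _ e%:E); last by rewrite lte_fin.
by apply: ge_ereal_sup => _ [i _ <-]; rewrite lee_fin.
Qed.

Lemma le_ordered x y : (forall i, x i <= y i) -> ordered x y.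
Proof.
by move=> xy; have [->|nxy] := pselect (x = y); [exact: Or32 | exact: Or31].
Qed.

Lemma ordered_sym x y : ordered x y -> ordered y x.
Proof. by case=> [xy|->|yx]; [exact: Or33 | exact: Or32 | exact: Or31]. Qed.

Lemma birkhoff_orderedP x : birkhoff x <->
  forall k l k' l', ordered (tau k l x) (tau k' l' x).
Proof.
split=> [xB k l k' l'|xB _ _ [[k l] _ <-] [[k' l'] _ <-]]; last exact: xB.
by apply: xB; [exists (k, l) | exists (k', l')].
Qed.

(** Moving two entries by less than [1 / 2] each changes their difference by
    less than [1]. *)
Lemma close_osc (r : nat) (K e : R) x X : e < 1 / 2 ->
  (osc r x <= K%:E)%E -> close e x X -> (osc r X <= (K + 1)%:E)%E.
Proof.
move=> e2 /osc_leP xK xX; apply/osc_leP => i j ij.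
move: (xK i j ij) (xX i) (xX j); rewrite !ltr_norml !ler_norml.
by move=> /andP[? ?] /andP[? ?] /andP[? ?]; apply/andP; split; lra.
Qed.

Lemma osc_tau (r : nat) (K : R) k l x :
  (osc r x <= K%:E)%E -> (osc r (tau k l x) <= K%:E)%E.
Proof.
move=> /osc_leP xK; apply/osc_leP => i j ij.
rewrite /tau opprD addrACA subrr addr0 xK //.
by rewrite opprD addrACA subrr addr0.
Qed.

Lemma tau0 x : tau 0 0 x = x.
Proof. by apply/funext => i; rewrite /tau !addr0. Qed.

Lemma close_tau (e : R) k l x X : close e x X -> close e (tau k l x) (tau k l X).
Proof. by move=> xX i; rewrite /tau opprD addrACA subrr addr0. Qed.

End Configurations.

(** * Continuations of recurrent Birkhoff minima *)

Theorem theorem5p2 (R : realType) (d : nat) (d_gt0 : (0 < d)%N)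
    (V : R -> R) (V_C2 : class_C2 V) (V_periodic : periodic V 1) (V_morse : morse V)
    (S : lattice d -> config R d -> R) (r : nat) (r_gt0 : (0 < r)%N)
    (SA : finite_range S r) (SB : shift_invariant S) (SC : twist S)
    (omega : 'rV[R]_d) (omega_irr : ~ rational_vector omega)
    (K : R) (K_gt0 : 0 < K)
    (K_osc : forall X : config R d,
       birkhoff X -> has_rotation_vector X omega -> (osc r X <= K%:E)%E)
    (c C1 C2 kappa delta0 eps0 : R)
    (consts : continuation_constants V S r K c C1 C2 kappa delta0 eps0) :
  exists eps1 : R, 0 < eps1 <= eps0 /\
    forall eps : R, 0 <= eps <= eps1 ->
    forall x : config R d,
      birkhoff x -> has_rotation_vector x omega -> recurrent omega x ->
      (forall i, derive1 V (x i) = 0) ->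
      (forall i, local_minimum V (x i)) ->
    exists X : config R d,
      is_continuation V S delta0 eps x X /\ birkhoff X.
Proof.
have [[c0 cV] [C10 C20 CS] /andP[k0 k1] [/andP[d0 d2] dV] eps0E] := consts.
(* The last two terms of [eps1] make [eps * B <= c / 4] and
   [eps * A <= c / 2 * (delta0 / 2)], the slope [c / 2] of the wells against the
   coupling in [comparison] and, on the box of radius [delta0 / 2], in
   [solution_near].  The [+ 1] avoids a division by zero. *)
pose N : R := (size (@ball_seq d r))%:R.
pose A := N * (C1 / (2 * r + 1)%:R ^+ d).
pose B := N ^+ 2 * (C2 / (2 * r + 1)%:R ^+ (2 * d)).
have A0 : 0 <= A by rewrite mulr_ge0 // divr_ge0 ?exprn_ge0 // ltW.
have B0 : 0 <= B by rewrite mulr_ge0 ?exprn_ge0 // divr_ge0 ?exprn_ge0 // ltW.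
pose eps1 := Num.min eps0 (Num.min (c / (4 * (B + 1))) (c * delta0 / (4 * (A + 1)))).
have eps00 : 0 < eps0.
  by rewrite eps0E lt_min !divr_gt0 ?mulr_gt0 //; lra.
exists eps1; split.
  by rewrite /eps1 ge_min lexx andbT !lt_min eps00 !divr_gt0 ?mulr_gt0 //; lra.
move=> eps /andP[e0]; rewrite !le_min => /and3P[ee0 eB eA] x xB xom _ xcrit xmin.
rewrite ler_pdivlMr in eB; last lra.
rewrite ler_pdivlMr in eA; last lra.
have {}eB : eps * B <= c / 2 / 2 by lra.
have {}eA : eps * A <= c / 2 * (delta0 / 2) by lra.
have c20 : 0 < c / 2 by rewrite divr_gt0.
have xosc := K_osc x xB xom.
have xwell i : well (derive1 V) (c / 2) delta0 (x i).
  apply: (local_minimum_well (q := kappa * c / 2)) => //; first exact: cV.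
    by rewrite ler_pM2r ?invr_gt0 // ger_pMl // ltW.
  by move=> t; exact: dV.
have tauwell k l i : well (derive1 V) (c / 2) delta0 (tau k l x i).
  by apply: well_shift => //; exact: periodic_derive1.
have taulip k l : lipschitz_near (total_force S) delta0 B (tau k l x).
  apply: total_force_lipschitz => // i j k' Z Zx.
  by have [] := CS Z (close_osc d2 (osc_tau k l xosc) Zx) k' j i.
have tausol k l Z : solution V S eps Z -> solution V S eps (tau k l Z).
  move=> Zsol i; rewrite (total_force_tau SA) // /tau periodic_int; first exact: Zsol.
  exact: periodic_derive1.
have Fanti i X1 X2 : (forall k, X1 k <= X2 k) -> X1 i = X2 i ->
  total_force S i X2 <= total_force S i X1 by apply: total_force_antitone SC.
have cmp k l k' l' Y Z : close delta0 x Y -> close delta0 x Z ->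
    solution V S eps Y -> solution V S eps Z ->
    (forall i, tau k l x i <= tau k' l' x i) ->
    forall i, tau k l Y i <= tau k' l' Z i.
  move=> Yx Zx Ys Zs xx.
  apply: (comparison c20 Fanti e0 eB (tauwell k l) (tauwell k' l') xx) => //.
  - exact: close_tau.
  - exact: close_tau.
  - by move=> i; rewrite tausol.
  - by move=> i; rewrite tausol.
have xlip : lipschitz_near (total_force S) delta0 B x by have := taulip 0 0; rewrite tau0.
have xbound Z i : close delta0 x Z -> `|total_force S i Z| <= A.
  move=> Zx; apply: (total_force_bound SA) => i' j.
  by have [] := CS Z (close_osc d2 xosc Zx) i' j 0.
have d02 : 0 < delta0 / 2 < delta0 by apply/andP; split; lra.
(* Half the radius, because [supball] is strict. *)
have [X Xe Xsol] := solution_near Fanti e0 B0 d02 eA xwell xlip xbound.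
have Xball : supball delta0 x X by apply: le_supball Xe; lra.
have Xx := supball_close Xball.
exists X; split; first split => // Y /supball_close Yx Ysol.
  (* Uniqueness is comparison of [x] with itself, in both directions. *)
  apply/funext => i; apply/eqP; rewrite eq_le -[Y]tau0 -[X]tau0.
  apply/andP; split; first exact: (cmp 0 0 0 0 Y X).
  exact: (cmp 0 0 0 0 X Y).
apply/birkhoff_orderedP => k l k' l'.
have [[_ xx]|xx|[_ xx]] := (birkhoff_orderedP x).1 xB k l k' l'.
- by apply: le_ordered; exact: cmp.
- by apply: le_ordered; apply: cmp => // i; rewrite xx.
- by apply/ordered_sym/le_ordered; exact: cmp.
Qed.
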